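(* Let $q,r$ be positive integers, and let $\zeta(\alpha_1,\alpha_2,\ldots,\alpha_q+1)$ (with $\alpha_1,\dots,\alpha_q$ positive integers) be a multiple zeta value of depth $q$ and weight $\alpha_1+\cdots+\alpha_q+1=q+r$, with dual $\zeta(\beta_1,\beta_2,\ldots,\beta_r+1)$ of depth $r$. Put $\boldsymbol\alpha=(\alpha_1,\ldots,\alpha_q)$ and $|\boldsymbol\alpha|=\alpha_1+\cdots+\alpha_q$. Then for every nonnegative integer $m$, $$\sum_{1\le k_1<k_2<\cdots<k_r}\frac{2^{2k_r}P_m\left(O_{k_r}^{(1)},\ldots,O_{k_r}^{(m)}\right)}{\binom{2k_r}{k_r}k_1^{\beta_1}k_2^{\beta_2}\cdots k_{r-1}^{\beta_{r-1}}k_r^{\beta_r+1}}=2^{|\boldsymbol\alpha|+1}\sum_{|\boldsymbol d|=m}M_{q-1}(\boldsymbol\alpha,\boldsymbol d)\binom{\alpha_q+d_q}{d_q}t(\alpha_1+d_1,\ldots,\alpha_{q-1}+d_{q-1},\alpha_q+d_q+1),$$ where the sum on the right is over all $q$-tuples $\boldsymbol d=(d_1,\ldots,d_q)$ of nonnegative integers with $|\boldsymbol d|=d_1+\cdots+d_q=m$.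
   Context: $O_n^{(s)}=\sum_{k=1}^n\frac{1}{(2k-1)^s}$. The modified Bell polynomials are defined by $\exp\left(\sum_{k\ge1}\frac{x_k}{k}z^k\right)=\sum_{m\ge0}P_m(x_1,\ldots,x_m)z^m$. $$M_{q-1}(\boldsymbol\alpha,\boldsymbol d)=\prod_{j=1}^{q-1}\binom{\alpha_j+d_j-1}{d_j}$$ (equal to $1$ if $q=1$). For positive integers $\alpha_1,\dots,\alpha_q$, $$t(\alpha_1,\ldots,\alpha_{q-1},\alpha_q+1)=\sum_{1\le n_1<\cdots<n_q}(2n_1-1)^{-\alpha_1}\cdots(2n_{q-1}-1)^{-\alpha_{q-1}}(2n_q-1)^{-\alpha_q-1},$$ $$\zeta(\alpha_1,\ldots,\alpha_{q-1},\alpha_q+1)=\sum_{1\le n_1<\cdots<n_q}n_1^{-\alpha_1}\cdots n_{q-1}^{-\alpha_{q-1}}n_q^{-\alpha_q-1}.$$ Duality: let $\{1\}^a$ denote $a$ repetitions of $1$. Every index can be written uniquely as $(\alpha_1,\ldots,\alpha_q+1)=(\{1\}^{a_1},b_1+2,\{1\}^{a_2},b_2+2,\ldots,\{1\}^{a_\ell},b_\ell+2)$ with nonnegative integers $a_i,b_i$; its dual index is $(\beta_1,\ldots,\beta_r+1)=(\{1\}^{b_\ell},a_\ell+2,\{1\}^{b_{\ell-1}},a_{\ell-1}+2,\ldots,\{1\}^{b_1},a_1+2)$, and $\zeta(\beta_1,\ldots,\beta_r+1)$ is called the dual of $\zeta(\alpha_1,\ldots,\alpha_q+1)$. *)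

(* Defs.v *)
From mathcomp Require Import all_boot all_order all_algebra.
From mathcomp Require Import all_classical all_reals all_analysis.
Set Implicit Arguments.
Unset Strict Implicit.
Unset Printing Implicit Defensive.
Import Order.TTheory GRing.Theory Num.Theory.
Local Open Scope classical_set_scope.
Local Open Scope ring_scope.

(* O_n^(s) *)
Definition oddharm (R : realType) (n s : nat) : R :=
  \sum_(1 <= k < n.+1) ((2 * k%:R - 1) ^+ s)^-1.

(* P_m(x_1, ..., x_m): the coefficient of z^m in the formal power series
   exp(\sum_(k >= 1) (x_k / k) z^k) = \sum_j (\sum_(k >= 1) (x_k / k) z^k)^j / j!.
   The inner series has no constant term, so neither j > m nor k > m
   contributes to this coefficient, and both sums are cut at m.  The value
   x 0 is not used. *)
Definition modBell (R : realType) (m : nat) (x : nat -> R) : R :=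
  (\sum_(j < m.+1) (j`!%:R)^-1 *:
     (\sum_(1 <= k < m.+1) (x k / k%:R) *: 'X^k) ^+ j)`_m.

(* (s_1, ..., s_q) |-> (s_1, ..., s_q + 1), for q > 0 *)
Definition incr_last (s : seq nat) : seq nat := incr_nth s (size s).-1.

(* 1 <= n_1 < ... < n_q *)
Definition increasing_tuples (q : nat) : set (q.-tuple nat) :=
  [set n | path ltn 0%N n].
Arguments increasing_tuples : clear implicits.

(* t(s_1, ..., s_q), with the largest summation variable attached to s_q.  All
   terms are positive, and the value is +oo if the series diverges. *)
Definition mtv (R : realType) (s : seq nat) : \bar R :=
  \esum_(n in increasing_tuples (size s))
    (\prod_(i < size s) ((2 * (tnth n i)%:R - 1) ^+ nth 0%N s i)^-1)%:E.

(* M_{q-1}(alpha, d), where q = size alpha *)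
Definition Mcoef (alpha d : seq nat) : nat :=
  \prod_(0 <= j < (size alpha).-1)
    'C(nth 0%N alpha j + nth 0%N d j - 1, nth 0%N d j).

(* ({1}^a_1, b_1 + 2, ..., {1}^a_l, b_l + 2) from the pairs (a_i, b_i) *)
Definition index_of_blocks (ab : seq (nat * nat)) : seq nat :=
  flatten [seq rcons (nseq p.1 1%N) p.2.+2 | p <- ab].

(* The blocks of s' are those of s in reverse order, with a_i and b_i
   exchanged. *)
Definition dual_index (s s' : seq nat) : Prop :=
  exists ab : seq (nat * nat),
    s = index_of_blocks ab /\
    s' = index_of_blocks (rev [seq (p.2, p.1) | p <- ab]).

(* Main.v *)
Require Import Defs.
From mathcomp Require Import all_boot all_order all_algebra.
From mathcomp Require Import all_classical all_reals all_analysis.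
From mathcomp Require Import ring lra zify.
Set Implicit Arguments.
Unset Strict Implicit.
Unset Printing Implicit Defensive.
Import Order.TTheory GRing.Theory Num.Theory.
Local Open Scope classical_set_scope.
Local Open Scope ring_scope.
Import numFieldNormedType.Exports.

(** Give the identity a variable z in ]0, 1[: multiply it by z^m and sum over m.
    All terms are nonnegative, so sums may be exchanged freely in \bar R, and
    the identities for all m together amount to one identity for every z
    ([esum_pow_inj]).  Put x = (1 + z) / 2 and write s, t for the indices
    (alpha_1, ..., alpha_q + 1) and (beta_1, ..., beta_r + 1).

    On the left, P_m(O_k) is the complete homogeneous symmetric polynomial of
    degree m in 1, 1/3, ..., 1/(2k-1), because both satisfy Newton's recurrence
    ([modBell_psum]).  Its generating function is
    \prod_(j <= k) (1 - z/(2j-1))^-1, and multiplied by 4^k / C(2k, k) this is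
    \prod_(j <= k) j/(j-x) ([bell_series]).  On the right, the binomials are the
    coefficients of the series of (1 - cz)^-a, and the sum over m is the
    Hurwitz-type sum of \prod_i (n_i - x)^-s_i ([mtv_series]).

    These two functions of x are equal by the method of connected sums of Seki
    and Yamamoto.  With the connector C(n, k) = \prod_(j <= k) j/(n+j-x), let
      Z(s; t) = \sum_n \sum_k \prod_i (n_i - x)^-s_i \prod_j k_j^-t_j C(n_q, k_r),
    where an empty tuple has last entry 0.  Two telescoping sums,
      \sum_(N > n) C(N, k) / (N - x) = C(n, k) / k          for k > 0,
      \sum_(N > k) C(n, N) / N = C(n, k) / (n - x)          for n > 0,
    move one unit of weight from s to t without changing Z ([transport_one],
    [transport_succ]).  Starting from t empty, where the connector is
    C(n, 0) = 1, and ending with s empty, where it is C(0, k), the index t has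
    become the dual of s ([nested_duality]).  Convergence follows from the first
    telescoping sum with k = 1 ([nested_fin]). *)

(** * Sums of nonnegative families *)

Lemma esumZl (R : realType) (T : choiceType) (I : set T) (c : R)
    (a : T -> \bar R) :
  0 <= c -> (forall i, I i -> 0 <= a i)%E ->
  (\esum_(i in I) (c%:E * a i) = c%:E * \esum_(i in I) a i)%E.
Proof.
move=> c0 a0; rewrite [esum I a]/esum -ereal_supZl//; last first.
  by apply/set0P; exists 0%E; exists set0; [exact: fsets_set0|rewrite fsbig_set0].
rewrite /esum image_comp; congr ereal_sup; apply: eq_imagel => A [finA AI] /=.
rewrite !fsbig_finite//= !big_seq ge0_sume_distrr// => i.
by rewrite in_fset_set// inE => /AI; exact: a0.
Qed.

Lemma exchange_esum (R : realType) (S T : choiceType) (I : set S) (J : set T)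
    (a : S -> T -> \bar R) :
  (forall i j, I i -> J j -> 0 <= a i j)%E ->
  (\esum_(i in I) \esum_(j in J) a i j = \esum_(j in J) \esum_(i in I) a i j)%E.
Proof.
move=> a0; rewrite esum_esum// esum_esum; last by move=> j i Jj Ii; exact: a0.
rewrite (reindex_esum (J `*`` fun=> I) _ (fun x => (x.2, x.1)))//; split=> //=.
- by move=> [j i] [/=].
- by move=> [j i] [j' i'] /= _ _ [] -> ->.
- by move=> [i j] [/= Ii Jj]; exists (j, i).
Qed.

Lemma esum_telescope (R : realType) (u : nat -> R) (n : nat) :
  (forall k, u k.+1 <= u k) -> u @ \oo --> 0 ->
  (\esum_(N in [set N | (n < N)%N]) (u N.-1 - u N)%:E = (u n)%:E)%E.
Proof.
move=> u_dec u0.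
rewrite (reindex_esum [set k | (n <= k)%N] _ succn); last first.
  split=> [k //|k l _ _ [] //|[//|k] nk]; by exists k.
rewrite -nneseries_esum; last by move=> k _; rewrite lee_fin subr_ge0.
have lim0 : limn (EFin \o (fun k => - u k)) = 0%E.
  apply/cvg_lim => //; apply: cvg_EFin; first exact: nearW.
  by rewrite -oppr0; apply: cvgN.
have := @nondecreasing_telescope_sumey R n (fun k => - u k).
rewrite lim0 => /(_ isT); rewrite eseries_cond.
rewrite (_ : (0 - (- u n)%:E)%E = (u n)%:E); last by rewrite add0e EFinN oppeK.
move=> <-; last first.
  move=> k l /subnK <-; elim: (l - k)%N => [|d IH] //.
  by rewrite addSn (le_trans IH)// lerN2.
apply: congr_lim; apply/funext => N; apply: eq_bigr => k _.
by rewrite /= -EFinB opprK addrC.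
Qed.

Lemma esum_tupleS (R : realType) (T : choiceType) (q : nat)
    (F : q.+1.-tuple T -> \bar R) :
  (forall d, 0 <= F d)%E ->
  (\esum_(d in [set: q.+1.-tuple T]) F d =
   \esum_(j in [set: T]) \esum_(d in [set: q.-tuple T]) F [tuple of j :: d])%E.
Proof.
move=> F0; rewrite esum_esum//.
rewrite (reindex_esum ([set: T] `*`` fun=> [set: q.-tuple T]) _
   (fun x => [tuple of x.1 :: x.2]))//; split=> //=.
- move=> [j d] [j' d'] _ _ /= /(congr1 val)/= [-> E].
  by congr (_, _); apply: val_inj.
- move=> d _; exists (thead d, [tuple of behead d]) => //=.
  by rewrite -tuple_eta.
Qed.

(** Distributivity: a product of q series is the sum, over all q-tuples of
    indices, of the products of their terms. *)
Lemma esum_prod_tuple (R : realType) (q : nat) (F : 'I_q -> nat -> R)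
    (v : 'I_q -> R) :
  (forall i j, 0 <= F i j) ->
  (forall i, \esum_(j in [set: nat]) (F i j)%:E = (v i)%:E)%E ->
  (\esum_(d in [set: q.-tuple nat]) (\prod_(i < q) F i (tnth d i))%:E =
   (\prod_(i < q) v i)%:E)%E.
Proof.
elim: q F v => [|q IH] F v F0 Fv.
  rewrite (_ : [set: 0.-tuple nat] = [set [tuple]]); last first.
    by apply/seteqP; split=> d _ //=; exact: tuple0.
  by rewrite esum_set1 !big_ord0.
rewrite esum_tupleS; last by move=> d; rewrite lee_fin prodr_ge0.
rewrite big_ord_recl EFinM -Fv muleC -esumZl; last 2 first.
- rewrite prodr_ge0// => i _; rewrite -lee_fin -Fv; apply: esum_ge0 => j _.
  by rewrite lee_fin.
- by move=> j _; rewrite lee_fin.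
apply: eq_esum => j _.
rewrite -(IH (fun i => F (lift ord0 i)))// muleC -esumZl//; last first.
  by move=> d _; rewrite lee_fin prodr_ge0.
apply: eq_esum => d _; rewrite -EFinM big_ord_recl.
congr (_ * _)%:E; apply: eq_bigr => i _; congr (F _ _).
by rewrite tnthS.
Qed.

Lemma increasing_tuple_gt0 (q : nat) (k : q.-tuple nat) (i : 'I_q) :
  increasing_tuples q k -> (0 < tnth k i)%N.
Proof.
by move=> /(order_path_min ltn_trans)/allP; apply; exact: mem_tnth.
Qed.

Lemma increasing_tuple_rcons (q : nat) (t : q.-tuple nat) (N : nat) :
  increasing_tuples q.+1 [tuple of rcons t N] <->
  increasing_tuples q t /\ (last 0%N t < N)%N.
Proof. by rewrite /increasing_tuples/= rcons_path; split=> /andP. Qed.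

(** Peels off the largest summation variable, so that sums over increasing
    tuples become nested sums. *)
Lemma esum_increasing_tuplesS (R : realType) (q : nat)
    (F : q.+1.-tuple nat -> \bar R) :
  (forall k, increasing_tuples q.+1 k -> 0 <= F k)%E ->
  (\esum_(k in increasing_tuples q.+1) F k =
   \esum_(t in increasing_tuples q)
     \esum_(N in [set N | (last 0%N t < N)%N]) F [tuple of rcons t N])%E.
Proof.
move=> F0; rewrite esum_esum; last first.
  by move=> t N tq tN; apply: F0; apply/increasing_tuple_rcons.
rewrite (reindex_esum (increasing_tuples q `*``
    fun t : q.-tuple nat => [set N | (last 0%N t < N)%N]) _
   (fun x => [tuple of rcons x.1 x.2]))//; split=> //=.
- by move=> [t N] tN; apply/increasing_tuple_rcons.
- move=> [t N] [t' N'] _ _ /= /(congr1 val)/= /rcons_inj[E ->].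
  by congr (_, _); apply: val_inj.
- case; case/lastP => // t N st; rewrite /increasing_tuples/= rcons_path.
  have st' : size t == q by rewrite size_rcons in st.
  move=> /andP[pt tN]; exists (Tuple st', N) => //=.
  exact: val_inj.
Qed.

Lemma esum_cauchy (R : realType) (a b : nat -> R) (A B : R) :
  (forall i, 0 <= a i) -> (forall i, 0 <= b i) ->
  (\esum_(i in [set: nat]) (a i)%:E = A%:E)%E ->
  (\esum_(i in [set: nat]) (b i)%:E = B%:E)%E ->
  (\esum_(m in [set: nat]) (\sum_(i < m.+1) a i * b (m - i)%N)%:E
    = (A * B)%:E)%E.
Proof.
move=> a0 b0 aA bB.
transitivity (\esum_(m in [set: nat])
    \esum_(i in [set i | (i <= m)%N]) (a i * b (m - i)%N)%:E)%E.
  apply: eq_esum => m _; rewrite (_ : [set i | (i <= m)%N] = `I_m.+1)//.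
  rewrite esum_fset ?finite_II//; last by move=> i _; rewrite lee_fin mulr_ge0.
  by rewrite -fsbig_ord sumEFin.
rewrite esum_esum; last by move=> m i _ _; rewrite lee_fin mulr_ge0.
rewrite mulrC EFinM -aA -esumZl; last 2 first.
- by rewrite -lee_fin -bB esum_ge0// => j _; rewrite lee_fin.
- by move=> i _; rewrite lee_fin.
transitivity (\esum_(i in [set: nat]) \esum_(j in [set: nat])
    (a i * b j)%:E)%E; last first.
  apply: eq_esum => i _; rewrite -bB muleC -esumZl//.
  by move=> j _; rewrite lee_fin.
rewrite esum_esum; last by move=> i j _ _; rewrite lee_fin mulr_ge0.
rewrite (reindex_esum ([set: nat] `*`` fun=> [set: nat]) _
    (fun x => (x.1 + x.2, x.1)%N)).
  by apply: eq_esum => -[i j] _ /=; rewrite addKn.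
split=> [[i j] _|[i j] [i' j'] _ _ /= [+ ii']|[m i] [_ im]] //=; last first.
- by exists (i, m - i)%N => //=; rewrite subnKC.
- by rewrite ii' => /addnI ->.
- by split=> //=; exact: leq_addr.
Qed.

Lemma esum_recl (R : realType) (f : nat -> \bar R) :
  (forall m, 0 <= f m)%E ->
  (\esum_(m in [set: nat]) f m = f 0%N + \esum_(m in [set: nat]) f m.+1)%E.
Proof.
move=> f0; rewrite -!nneseries_esumT// nneseries_recl//; congr (_ + _)%E.
rewrite -(nneseries_addn 1)//.
by apply: eq_eseriesr => i _; rewrite addn1.
Qed.

(** * Uniqueness of the coefficients of a power series *)

Section power_series.
Variable R : realType.
Implicit Types A B : nat -> \bar R.

Let PS A (z : R) : \bar R := (\esum_(m in [set: nat]) ((z ^+ m)%:E * A m))%E.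

Let term_ge0 A z m : 0 <= z -> (forall m, 0 <= A m)%E ->
  (0 <= (z ^+ m)%:E * A m)%E.
Proof. by move=> z0 A0; rewrite mule_ge0// lee_fin exprn_ge0. Qed.

Let PS_ge0 A z : 0 <= z -> (forall m, 0 <= A m)%E -> (0 <= PS A z)%E.
Proof.
move=> z0 A0; apply: esum_ge0 => m _; exact: term_ge0.
Qed.

Let PS_recl A z : 0 <= z -> (forall m, 0 <= A m)%E ->
  (PS A z = A 0%N + z%:E * PS (A \o succn) z)%E.
Proof.
move=> z0 A0; rewrite /PS esum_recl; last by move=> m; exact: term_ge0.
rewrite expr0 mul1e; congr (_ + _)%E; rewrite -esumZl//; last first.
  by move=> m _; apply: term_ge0 => // k; exact: A0.
by apply: eq_esum => m _; rewrite exprS EFinM muleA.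
Qed.

Let PS_le A z z' : 0 <= z <= z' -> (forall m, 0 <= A m)%E ->
  (PS A z <= PS A z')%E.
Proof.
move=> /andP[z0 zz'] A0; apply: le_esum => m _; apply: lee_wpmul2r => //.
by rewrite lee_fin lerXn2r// ?nnegrE// (le_trans z0).
Qed.

Let same A B := forall z : R, 0 < z < 1 ->
  PS A z = PS B z /\ PS A z \is a fin_num.

Let PS_fin A z : 0 < z -> (forall m, 0 <= A m)%E -> PS A z \is a fin_num ->
  A 0%N \is a fin_num /\ PS (A \o succn) z \is a fin_num.
Proof.
move=> z0 A0; rewrite PS_recl ?ltW// fin_numD => /andP[-> zA]; split=> //.
have := fin_numM (isT : (z^-1)%:E \is a fin_num) zA.
by rewrite muleA -EFinM mulVf ?gt_eqF// mul1e.
Qed.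

(** The terms beyond the constant one contribute at most z K for z <= 1/2, where
    K is the shifted series at 1/2; hence A_0 <= B_0 + z K for all small z. *)
Let same_le A B : (forall m, 0 <= A m)%E -> (forall m, 0 <= B m)%E ->
  same A B -> (A 0%N <= B 0%N)%E.
Proof.
move=> A0 B0 AB; apply/lee_addgt0Pr => e e0.
have h : 0 < (2^-1 : R) < 1 by apply/andP; split; lra.
have [ABh Afin] := AB _ h.
rewrite ABh in Afin; have [_ ] := PS_fin (proj1 (andP h)) B0 Afin.
set K := PS _ _ => Kfin.
have K0 : (0 <= K)%E by apply: PS_ge0 => [|m]; [lra|exact: B0].
have k0 := fine_ge0 K0.
pose z := Num.min 2^-1 (e / (fine K + 1)).
have z0 : 0 < z by rewrite lt_min divr_gt0//; lra.
have zh : z <= 2^-1 by rewrite ge_min lexx.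
have z1 : z < 1 by apply: le_lt_trans zh _; lra.
have [+ _] := AB z ltac:(by rewrite z0 z1).
rewrite (PS_recl (ltW z0) A0) (PS_recl (ltW z0) B0) => E.
apply: (@le_trans _ _ (A 0%N + z%:E * PS (A \o succn) z)%E).
  rewrite leeDl// mule_ge0//; first by rewrite lee_fin ltW.
  by apply: PS_ge0 => [|m]; [exact: ltW|exact: A0].
rewrite E leeD2l//; apply: (@le_trans _ _ (z%:E * K)%E).
  apply: lee_wpmul2l; first by rewrite lee_fin ltW.
  by apply: PS_le => [|m]; [rewrite (ltW z0) zh|exact: B0].
rewrite -[K]fineK// -EFinM lee_fin.
have : z <= e / (fine K + 1) by rewrite ge_min lexx orbT.
rewrite ler_pdivlMr; last lra.
by move: (ltW z0) k0; nra.
Qed.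

(** Equality of the constant terms comes from letting z tend to 0; subtracting
    them and dividing by z gives the same hypotheses for the shifted series. *)
Lemma esum_pow_inj A B : (forall m, 0 <= A m)%E -> (forall m, 0 <= B m)%E ->
  (forall z : R, 0 < z < 1 ->
     \esum_(m in [set: nat]) ((z ^+ m)%:E * A m)%E =
       \esum_(m in [set: nat]) ((z ^+ m)%:E * B m)%E /\
     \esum_(m in [set: nat]) ((z ^+ m)%:E * A m)%E \is a fin_num) ->
  forall m, A m \is a fin_num /\ A m = B m.
Proof.
move=> A0 B0 AB m; elim: m A B A0 B0 AB => [|m IH] A B A0 B0 AB.
  have h : 0 < (2^-1 : R) < 1 by apply/andP; split; lra.
  split; first by have [_ /PS_fin[]//] := AB _ h; case/andP: h.
  apply/eqP; rewrite eq_le !same_le// => z /AB[E]; rewrite /PS E; split=> //.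
apply: (IH (A \o succn) (B \o succn)) => [k|k|z z01].
- exact: A0.
- exact: B0.
have [E Afin] := AB z z01; move/andP: (z01) => [z0 z1].
have [A0fin SAfin] := PS_fin z0 A0 Afin; split=> //.
have A0B0 : A 0%N = B 0%N.
  apply/eqP; rewrite eq_le !same_le// => y /AB[F]; rewrite /PS F; split=> //.
move: E; rewrite -/(PS A z) -/(PS B z) (PS_recl (ltW z0) A0) (PS_recl (ltW z0) B0).
rewrite -A0B0 => /(congr1 (fun x => (z^-1)%R%:E * (x - A 0%N))%E).
rewrite -!(addeC (z%:E * _)%E) !addeK//.
by rewrite !muleA -!EFinM mulVf ?gt_eqF// !mul1e.
Qed.
End power_series.

(** * Complete homogeneous symmetric polynomials and Bell polynomials *)

Section complete_homogeneous.
Variable R : realType.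
Implicit Types (cs : seq R) (x : nat -> R).

(** The complete homogeneous symmetric polynomial of degree m evaluated at the
    entries of cs, that is, the coefficient of z^m in \prod_c (1 - cz)^-1. *)
Fixpoint hsym cs (m : nat) : R :=
  if cs is c :: cs' then \sum_(i < m.+1) c ^+ i * hsym cs' (m - i)%N
  else (m == 0%N)%:R.

Lemma hsym_nil m : hsym [::] m = (m == 0%N)%:R.
Proof. by []. Qed.

Lemma hsym_cons c cs m :
  hsym (c :: cs) m = \sum_(i < m.+1) c ^+ i * hsym cs (m - i)%N.
Proof. by []. Qed.

Arguments hsym : simpl never.

Lemma hsym0 cs : hsym cs 0 = 1.
Proof.
elim: cs => [|c cs IH]; first by rewrite hsym_nil.
by rewrite hsym_cons big_ord1 mul1r IH.
Qed.

Lemma hsym_rec c cs m :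
  hsym (c :: cs) m.+1 = hsym cs m.+1 + c * hsym (c :: cs) m.
Proof.
rewrite !hsym_cons big_ord_recl mul1r subn0; congr (_ + _).
rewrite mulr_sumr; apply: eq_bigr => i _.
by rewrite lift0 subSS exprS mulrA.
Qed.

Lemma hsym_ge0 cs m : (forall c, c \in cs -> 0 <= c) -> 0 <= hsym cs m.
Proof.
elim: cs m => [|c cs IH] m cs0; first by rewrite hsym_nil ler0n.
rewrite hsym_cons.
apply: sumr_ge0 => i _; apply: mulr_ge0;
  first by rewrite exprn_ge0// cs0 ?mem_head.
by apply: IH => d dcs; rewrite cs0// in_cons dcs orbT.
Qed.

Lemma hsym_nseq a c m : hsym (nseq a c) m = 'C(a + m - 1, m)%:R * c ^+ m.
Proof.
elim: a m => [|a IHa] m.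
  rewrite hsym_nil; case: m => [|m] /=; first by rewrite mulr1.
  by rewrite add0n subn1 bin_small// mul0r.
elim: m => [|m IHm]; first by rewrite hsym0 bin0 mulr1.
rewrite -[nseq _ _]/(c :: nseq a c) hsym_rec IHa -[_ :: _]/(nseq a.+1 c) IHm.
rewrite !addSn !subn1/= addnS/= binS natrD exprS; ring.
Qed.

Lemma esum_hsym cs (z : R) : (forall c, c \in cs -> 0 <= c * z < 1 /\ 0 <= c) ->
  0 <= z ->
  (\esum_(m in [set: nat]) (hsym cs m * z ^+ m)%:E =
   (\prod_(c <- cs) (1 - c * z)^-1)%:E)%E.
Proof.
move=> + z0; elim: cs => [|c cs IH] cs1.
  rewrite big_nil (esumID [set 0%N])//=; last first.
    by move=> m _; rewrite hsym_nil lee_fin mulr_ge0// exprn_ge0.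
  rewrite setTI esum_set1 hsym_nil ?mulr1 ?lee_fin// setTI esum1 ?adde0//.
  by case=> [nz|m _]; [by case: nz|]; rewrite hsym_nil mul0r.
have [/andP[cz0 cz1] c0] := cs1 c (mem_head _ _).
have cs1' d : d \in cs -> 0 <= d * z < 1 /\ 0 <= d.
  by move=> dcs; apply: cs1; rewrite in_cons dcs orbT.
rewrite big_cons -(@esum_cauchy _ (fun i => (c * z) ^+ i)
    (fun i => hsym cs i * z ^+ i) _ _ _ _ _ (IH cs1')) => [|i|i|].
- apply: eq_esum => m _; congr (_%:E); rewrite hsym_cons mulr_suml.
  apply: eq_bigr => i _.
  rewrite (_ : z ^+ m = z ^+ i * z ^+ (m - i)); last first.
    by rewrite -exprD subnKC// -ltnS.
  by rewrite exprMn; ring.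
- by rewrite /= exprn_ge0.
- by rewrite mulr_ge0 ?exprn_ge0// hsym_ge0// => d /cs1'[].
rewrite -nneseries_esumT; last by move=> i; rewrite lee_fin exprn_ge0.
apply/cvg_lim => //; rewrite (_ : (fun _ => _) =
    EFin \o series (fun i => (c * z) ^+ i)).
  apply: cvg_EFin; first exact: nearW.
  have := @cvg_geometric_series R 1 (c * z); rewrite ger0_norm// div1r => /(_ cz1).
  rewrite (_ : geometric 1 (c * z) = (fun i => (c * z) ^+ i))//.
  by apply/funext => i; rewrite /= mul1r.
by apply/funext => n /=; rewrite sumEFin.
Qed.

Definition psum cs (i : nat) : R := \sum_(c <- cs) c ^+ i.

(** Newton's recurrence for complete homogeneous polynomials, by induction on cs
    and then on m through [hsym_rec]. *)
Lemma newton cs m :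
  m%:R * hsym cs m = \sum_(i < m) psum cs i.+1 * hsym cs (m - i.+1)%N.
Proof.
elim: cs m => [|c cs IHcs] m.
  rewrite big1 => [|i _]; last by rewrite /psum big_nil mul0r.
  by rewrite hsym_nil; case: m => [|m]; rewrite ?mul0r ?mulr0.
elim: m => [|m IHm]; first by rewrite mul0r big_ord0.
have psumS i : psum (c :: cs) i = c ^+ i + psum cs i by rewrite /psum big_cons.
rewrite hsym_rec mulrDr IHcs mulrCA -natr1 [(m%:R + 1) * hsym (c :: _) _]mulrDl IHm mul1r.
under [RHS]eq_bigr do rewrite psumS mulrDl.
rewrite big_split/=.
have -> : \sum_(i < m.+1) psum cs i.+1 * hsym (c :: cs) (m.+1 - i.+1)
   = \sum_(i < m.+1) psum cs i.+1 * hsym cs (m.+1 - i.+1)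
   + c * \sum_(i < m) psum cs i.+1 * hsym (c :: cs) (m - i.+1).
  rewrite !big_ord_recr/= !subnn !hsym0 mulr_sumr addrAC -big_split/=; congr (_ + _).
  apply: eq_bigr => i _; rewrite subSS.
  rewrite -(subnSK (ltn_ord i)) hsym_rec; ring.
have -> : \sum_(i < m.+1) c ^+ i.+1 * hsym (c :: cs) (m.+1 - i.+1)
  = c * hsym (c :: cs) m + c * \sum_(i < m) c ^+ i.+1 * hsym (c :: cs) (m - i.+1).
  rewrite big_ord_recl subSS subn0 expr1; congr (_ + _); rewrite mulr_sumr.
  by apply: eq_bigr => i _; rewrite lift0 subSS [c ^+ i.+2]exprS mulrA.
under [X in _ + c * (X + _) = _]eq_bigr do rewrite psumS mulrDl.
rewrite big_split/=; ring.
Qed.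
End complete_homogeneous.

Section bell.
Variable R : realType.
Implicit Types (x : nat -> R) (p u : {poly R}).

(** A power series u without constant term has u^j divisible by X^j. *)
Lemma coef_pow_low u j i : u`_0 = 0 -> (i < j)%N -> (u ^+ j)`_i = 0.
Proof.
move=> u0 ij; have : 'X %| u.
  rewrite -['X]subr0 -[0]/(polyC 0) dvdp_XsubCl; apply/rootP.
  by rewrite horner_coef0.
move=> /(dvdp_exp2r j)/dvdpP[v ->].
by rewrite coefMXn ij.
Qed.

Let U x m : {poly R} := \sum_(1 <= k < m.+1) (x k / k%:R) *: 'X^k.

Let coefU x m i : (U x m)`_i = if (0 < i <= m)%N then x i / i%:R else 0.
Proof.
rewrite coef_sum; under eq_bigr do rewrite coefZ coefXn.
case: ifPn => im.
  rewrite (bigD1_seq i) ?mem_index_iota ?iota_uniq//= eqxx mulr1.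
  by rewrite big1 ?addr0// => k /negPf; rewrite eq_sym => ->; rewrite mulr0.
rewrite big_seq big1// => k; rewrite mem_index_iota ltnS => km.
by case: eqP => [ik|_]; [rewrite ik km in im|rewrite mulr0].
Qed.

(** The truncated exponential of the truncated series U x m; [coefE] shows that
    its coefficients of degree at most m do not depend on the truncation. *)
Let E x m : {poly R} := \sum_(j < m.+1) (j`!%:R)^-1 *: U x m ^+ j.

Let coefE x m l : (l <= m)%N -> (E x m)`_l = modBell l x.
Proof.
move=> lm; rewrite /modBell -/(U x l) -/(E x l) /E.
rewrite -(subnKC lm) -addSn big_split_ord/= coefD [X in _ + X]coef_sum.
rewrite [X in _ + X]big1 ?addr0 => [|j _]; last first.
  by rewrite coefZ coef_pow_low ?mulr0// ?coefU// ltn_addr.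
rewrite !coef_sum; apply: eq_bigr => j _; rewrite !coefZ; congr (_ * _).
rewrite subnKC//.
have /dvdpP[v Dv] : 'X^(l.+1) %| U x m - U x l.
  rewrite (_ : U x m - U x l = \sum_(l.+1 <= k < m.+1) (x k / k%:R) *: 'X^k).
    rewrite big_seq; apply: (big_ind (fun p => 'X^(l.+1) %| p)) => [|a b|k];
      [exact: dvdp0|exact: dvdp_add|].
    by rewrite mem_index_iota => /andP[lk _]; rewrite -mul_polyC dvdp_mull ?dvdp_exp2l.
  by rewrite /U (big_cat_nat (n := l.+1))//= addrAC subrr add0r.
have : (U x m ^+ j - U x l ^+ j)`_l = 0.
  by rewrite subrXX Dv -mulrA mulrCA mulrC coefMXn ltnS leqnn.
by rewrite coefB => /eqP; rewrite subr_eq0 => /eqP.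
Qed.

(** The differential equation E' = U' E, up to the term lost by truncation; that
    term only affects coefficients of degree at least m. *)
Let deriv_E x m :
  (E x m)^`() = (U x m)^`() * (E x m - (m`!%:R)^-1 *: U x m ^+ m).
Proof.
rewrite /E [in RHS]big_ord_recr/= addrK raddf_sum big_ord_recl/= expr0.
rewrite derivZ derivC scaler0 add0r mulr_sumr.
apply: eq_bigr => j _; rewrite derivZ deriv_exp /bump add1n -scalerAr/=.
rewrite -[X in _ *: X = _]scaler_nat scalerA factS natrM invfM mulrAC mulVf ?mul1r; last first.
  by rewrite pnatr_eq0.
by [].
Qed.

Lemma modBell_rec x m :
  m%:R * modBell m x = \sum_(i < m) x i.+1 * modBell (m - i.+1) x.
Proof.
case: m => [|m]; first by rewrite mul0r big_ord0.
have := congr1 (fun p : {poly R} => p`_m) (deriv_E x m.+1).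
rewrite coef_deriv coefE// mulr_natl => ->.
rewrite coefM; apply: eq_bigr => i _.
rewrite coef_deriv coefU ltnS (ltn_ord i)/= coefB coefZ.
rewrite coef_pow_low ?coefU// ?mulr0 ?subr0; last by rewrite ltnS leq_subr.
rewrite coefE ?(leq_trans (leq_subr _ _))// subSS -[x _ / _ *+ _]mulr_natr divfK//.
Qed.

(** The recurrence [modBell_rec] is Newton's, so the power sums of cs are sent to
    its complete homogeneous polynomials. *)
Lemma modBell_psum x (cs : seq R) m :
  (forall i, (0 < i)%N -> x i = psum cs i) -> modBell m x = hsym cs m.
Proof.
move=> xE; elim/ltn_ind: m => -[_|m IH].
  by rewrite hsym0 -(@coefE x 0 0)// /E big_ord1 expr0 fact0 invr1 scale1r coefC.
apply: (@mulfI _ m.+1%:R); first by rewrite pnatr_eq0.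
rewrite modBell_rec newton; apply: eq_bigr => i _.
by rewrite xE// IH// subSS ltnS leq_subr.
Qed.
End bell.

(** * Nested sums over increasing tuples *)

Section nested_sums.
Variable R : realType.
Implicit Types (w : nat -> R) (s : seq nat) (G : nat -> \bar R).

(** The sum of \prod_i (w n_i)^s_i G(n_q) over n_1 < ... < n_q, with G evaluated at
    0 for the empty index.  The index s is listed from the largest summation
    variable downwards, so that the recursion removes the variable on which G
    depends. *)
Fixpoint nested w s G : \bar R :=
  if s is a :: s' then
    nested w s' (fun n =>
      \esum_(N in [set N | (n < N)%N]) ((w N ^+ a)%:E * G N))%E
  else G 0%N.

Lemma nested_cons w a s G : nested w (a :: s) G =
  nested w s (fun n =>
    \esum_(N in [set N | (n < N)%N]) ((w N ^+ a)%:E * G N))%E.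
Proof. by []. Qed.

Lemma nested_eq_pos w a s G G' : (forall n, (0 < n)%N -> G n = G' n) ->
  nested w (a :: s) G = nested w (a :: s) G'.
Proof.
move=> GG'; rewrite !nested_cons; congr nested; apply/funext => n.
by apply: eq_esum => N /= nN; rewrite GG' ?(leq_ltn_trans _ nN).
Qed.

Variable w : nat -> R.
Hypothesis w0 : forall N, (0 < N)%N -> 0 <= w N.

Lemma weighted_ge0 G a n N : (forall n, 0 <= G n)%E -> (n < N)%N ->
  (0 <= (w N ^+ a)%:E * G N)%E.
Proof.
move=> G0 nN; rewrite mule_ge0// lee_fin exprn_ge0// w0//.
exact: leq_ltn_trans nN.
Qed.

Lemma nested_ge0 s G : (forall n, 0 <= G n)%E -> (0 <= nested w s G)%E.
Proof.
elim: s G => [|a s IH] G G0 //=; apply: IH => n.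
by apply: esum_ge0 => N; exact: weighted_ge0.
Qed.

Lemma le_nested s G G' : (forall n, G n <= G' n)%E ->
  (nested w s G <= nested w s G')%E.
Proof.
elim: s G G' => [|a s IH] G G' GG' //=; apply: IH => n; apply: le_esum => N nN.
apply: lee_wpmul2l => //.
by rewrite lee_fin exprn_ge0// w0//; exact: leq_ltn_trans nN.
Qed.

Lemma nestedZl s G (c : R) : 0 <= c -> (forall n, 0 <= G n)%E ->
  (nested w s (fun n => c%:E * G n) = c%:E * nested w s G)%E.
Proof.
move=> c0; elim: s G => [|a s IH] G G0 //=.
rewrite -IH; last by move=> n; apply: esum_ge0 => N; exact: weighted_ge0.
congr nested; apply/funext => n; rewrite -esumZl//; last first.
  by move=> N; exact: weighted_ge0.
by apply: eq_esum => N _; rewrite muleCA.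
Qed.

Lemma nested_esum (T : choiceType) (I : set T) s (F : T -> nat -> \bar R) :
  (forall i n, I i -> 0 <= F i n)%E ->
  (nested w s (fun n => \esum_(i in I) F i n) =
   \esum_(i in I) nested w s (F i))%E.
Proof.
elim: s F => [|a s IH] F F0 //=.
rewrite -IH; last first.
  by move=> i n Ii; apply: esum_ge0 => N; rewrite /= => nN;
    rewrite mule_ge0 ?F0// lee_fin exprn_ge0// w0//; exact: leq_ltn_trans nN.
congr nested; apply/funext => n; rewrite exchange_esum; last first.
  move=> i N Ii nN; rewrite mule_ge0 ?F0// lee_fin exprn_ge0// w0//.
  exact: leq_ltn_trans nN.
apply: eq_esum => N nN; rewrite esumZl//; last by move=> i Ii; exact: F0.
by rewrite exprn_ge0// w0//; exact: leq_ltn_trans nN.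
Qed.

Lemma esum_increasing_nested (q : nat) s G : size s = q ->
  (forall n, 0 <= G n)%E ->
  (\esum_(k in increasing_tuples q)
     ((\prod_(i < q) w (tnth k i) ^+ nth 0%N s i)%:E * G (last 0%N k)) =
   nested w (rev s) G)%E.
Proof.
have prod_ge0 p (k : p.-tuple nat) (e : nat -> nat) : increasing_tuples p k ->
    0 <= \prod_(i < p) w (tnth k i) ^+ e i.
  move=> kp; apply: prodr_ge0 => i _.
  by rewrite exprn_ge0// w0// increasing_tuple_gt0.
elim: q s G => [|q IH] s G.
  move=> /size0nil -> G0; rewrite (_ : increasing_tuples 0 = [set [tuple]]).
    by rewrite esum_set1 big_ord0 mul1e.
  by apply/seteqP; split=> d //= _; [exact: tuple0|rewrite /increasing_tuples (tuple0 d)].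
case/lastP: s => // s a; rewrite size_rcons rev_rcons => -[sq] G0.
rewrite nested_cons esum_increasing_tuplesS; last first.
  by move=> k kq; rewrite mule_ge0// lee_fin prod_ge0.
rewrite -IH//; last by move=> n; apply: esum_ge0 => N; exact: weighted_ge0.
apply: eq_esum => t tq; rewrite -esumZl ?prod_ge0//; last first.
  by move=> N; exact: weighted_ge0.
apply: eq_esum => N tN; rewrite /= last_rcons muleA -EFinM; congr (_%:E * _)%E.
rewrite big_ord_recr/=; congr (_ * _); last first.
  by rewrite (tnth_nth 0%N)/= !nth_rcons size_tuple sq ltnn eqxx.
apply: eq_bigr => i _.
by rewrite !(tnth_nth 0%N)/= !nth_rcons size_tuple sq ltn_ord.
Qed.

End nested_sums.

(** * The connector and its telescoping sums *)

Definition shifted_inv (R : realType) (x : R) (N : nat) : R := (N%:R - x)^-1.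

Section connector.
Variables (R : realType) (x : R).
Hypothesis x1 : x < 1.

Definition connector (n k : nat) : R :=
  \prod_(j < k) (j.+1%:R / (n%:R + j.+1%:R - x)).

Let den_gt0 n j : 0 < n%:R + j.+1%:R - x.
Proof. by rewrite -natr1; have := ler0n R n; have := ler0n R j; move: x1; lra. Qed.

Let shifted_gt0 n : 0 < n.+1%:R - x.
Proof. by have := den_gt0 n 0; rewrite natr1. Qed.

Lemma connector_gt0 n k : 0 < connector n k.
Proof. by apply: prodr_gt0 => j _; rewrite divr_gt0. Qed.

Lemma connector0 n : connector n 0 = 1.
Proof. exact: big_ord0. Qed.

Lemma connectorSr n k :
  connector n k.+1 = connector n k * (k.+1%:R / (n%:R + k.+1%:R - x)).
Proof. by rewrite /connector big_ord_recr. Qed.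

(** Shifting n by one cancels all but the extreme denominators. *)
Let connectorSl n k :
  connector n k * (n.+1%:R - x) = connector n.+1 k * (n.+1%:R + k%:R - x).
Proof.
elim: k => [|k IH]; first by rewrite !connector0 addr0.
rewrite !connectorSr [LHS]mulrAC {}IH.
have h : n.+1%:R + k%:R = n%:R + k.+1%:R :> R by rewrite -!natr1; ring.
have := den_gt0 n k; have := den_gt0 n.+1 k; rewrite h => d1 d2.
by field; apply/andP; split; apply: lt0r_neq0; lra.
Qed.

Lemma connector_diffl n k : connector n k - connector n.+1 k =
  k%:R / (n.+1%:R - x) * connector n.+1 k.
Proof.
have d := shifted_gt0 n.
apply: (@mulIf _ (n.+1%:R - x)); first by rewrite gt_eqF.
by rewrite mulrBl connectorSl; field; apply: lt0r_neq0; lra.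
Qed.

Lemma connector_diffr n k : connector n k - connector n k.+1 =
  (n%:R - x) / k.+1%:R * connector n k.+1.
Proof.
rewrite connectorSr; have d := den_gt0 n k.
have := ltr0Sn R k; move=> k0.
by field; apply/andP; split; apply: lt0r_neq0; lra.
Qed.

Let connector_decl k n : connector n.+1 k <= connector n k.
Proof.
rewrite -subr_ge0 connector_diffl mulr_ge0 ?divr_ge0// ltW//.
exact: connector_gt0.
Qed.

Let connector_decr n k : (0 < n)%N -> connector n k.+1 <= connector n k.
Proof.
case: n => // n _; rewrite -subr_ge0 connector_diffr mulr_ge0 ?divr_ge0// ltW//.
exact: connector_gt0.
Qed.

(** For n > 0 the connector decreases in k, so it is at most its value
    1/(n+1-x) at k = 1. *)
Lemma cvg_connectorl k : (0 < k)%N -> connector n k @[n --> \oo] --> 0.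
Proof.
move=> k0; rewrite -cvg_shiftS; apply: (@squeeze_cvgr _ _ _ _ (fun=> 0) (@harmonic R)).
- apply: nearW => n; rewrite ltW ?connector_gt0//=.
  apply: (@le_trans _ _ (connector n.+1 1)).
    case: k k0 => // k _; elim: k => // k IH.
    by apply: le_trans IH; exact: connector_decr.
  rewrite connectorSr connector0 mul1r div1r lef_pV2 ?posrE//.
  by move: x1; lra.
- exact: cvg_cst.
- exact: cvg_harmonic.
Qed.

(** With y = n - x > 0 the inverse of the connector is
    \prod_(j <= k) (1 + y/j) >= 1 + y \sum_(j <= k) 1/j, and the harmonic series
    diverges. *)
Lemma cvg_connectorr n : (0 < n)%N -> connector n k @[k --> \oo] --> 0.
Proof.
move=> n0; have y0 : 0 < n%:R - x by case: n n0.
set y := n%:R - x.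
have H0 k : 0 <= series (@harmonic R) k by apply: sumr_ge0 => i _; exact: harmonic_ge0.
have bound k : connector n k * (1 + y * series harmonic k) <= 1.
  elim: k => [|k IH].
    by rewrite connector0 /series/= big_geq// mulr0 addr0 mulr1.
  apply: le_trans IH; rewrite connectorSr -mulrA ler_wpM2l ?(ltW (connector_gt0 n k))//.
  rewrite seriesSr /harmonic/=; set H := series _ k.
  have -> : n%:R + k.+1%:R - x = k.+1%:R + y by rewrite /y; ring.
  have k0 : (0 : R) < k.+1%:R by [].
  rewrite mulrAC ler_pdivrMr; last by rewrite addr_gt0.
  have -> : k.+1%:R * (1 + y * (H + k.+1%:R^-1)) = k.+1%:R * (1 + y * H) + y.
    by field; rewrite gt_eqF.
  have yyH : 0 <= y * (y * H) by rewrite !mulr_ge0 ?(ltW y0)//; exact: H0 k.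
  rewrite -subr_ge0 (_ : _ - _ = y * (y * H))//; ring.
have Hoo : series (@harmonic R) k @[k --> \oo] --> +oo.
  apply: nondecreasing_dvgn_lt; last exact: dvg_harmonic.
  by apply: nondecreasing_series => i _ _; exact: harmonic_ge0.
apply/cvgrPdist_lt => e e0; near=> k.
rewrite sub0r normrN gtr0_norm ?connector_gt0//.
have Hk : (e * y)^-1 < series harmonic k.
  by near: k; exact: (cvgryPgt _).1.
rewrite ltNge; apply/negP => ec.
have yH : 0 <= y * series harmonic k by rewrite mulr_ge0 ?(ltW y0).
have : e * (1 + y * series harmonic k) <= 1.
  by apply: le_trans (bound k); rewrite ler_wpM2r// addr_ge0.
rewrite leNgt => /negP; apply.
move: Hk; rewrite -div1r ltr_pdivrMr ?mulr_gt0// => Hk.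
by apply: (lt_trans Hk); rewrite -subr_gt0 (_ : _ - _ = e)//; ring.
Unshelve. all: by end_near.
Qed.

(** By [connector_diffl] the summand is the decrement of C(N, k) / k from N - 1 to
    N. *)
Lemma esum_connectorl n k : (0 < k)%N ->
  (\esum_(N in [set N | (n < N)%N]) ((shifted_inv x N)%:E * (connector N k)%:E) =
   (shifted_inv 0 k * connector n k)%:E)%E.
Proof.
move=> k0; have k0' : (0 : R) < k%:R by rewrite ltr0n.
rewrite /shifted_inv subr0 -(@esum_telescope _ (fun n => k%:R^-1 * connector n k)).
- apply: eq_esum => -[//|N] _ /=; rewrite -mulrBr connector_diffl -EFinM.
  by congr (_%:E); rewrite mulrA mulrA mulVf ?mul1r// gt_eqF.
- by move=> N; rewrite ler_wpM2l// invr_ge0 ltW.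
- by rewrite -(mulr0 k%:R^-1); apply: cvgZr; exact: cvg_connectorl.
Qed.

(** By [connector_diffr] the summand is the decrement of C(n, N) / (n - x) from
    N - 1 to N. *)
Lemma esum_connectorr n k : (0 < n)%N ->
  (\esum_(N in [set N | (k < N)%N]) ((shifted_inv 0 N)%:E * (connector n N)%:E) =
   (shifted_inv x n * connector n k)%:E)%E.
Proof.
move=> n0; have y0 : 0 < n%:R - x by case: n n0.
rewrite /shifted_inv -(@esum_telescope _ (fun k => (n%:R - x)^-1 * connector n k)).
- apply: eq_esum => -[//|N] _ /=; rewrite subr0 -mulrBr connector_diffr -EFinM.
  by congr (_%:E); rewrite !mulrA mulVf ?mul1r// gt_eqF.
- by move=> N; rewrite ler_wpM2l ?connector_decr// invr_ge0 ltW.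
- by rewrite -(mulr0 (n%:R - x)^-1); apply: cvgZr; exact: cvg_connectorr.
Qed.
End connector.

(** * Transport of connected sums and duality *)

Section duality.
Variables (R : realType) (x : R).
Hypothesis x1 : x < 1.

Lemma shifted_inv_gt0 (y : R) N : y < 1 -> (0 < N)%N -> 0 < shifted_inv y N.
Proof.
case: N => // N y1 _; rewrite invr_gt0 -natr1.
by have := ler0n R N; lra.
Qed.

Let wx_ge0 N : (0 < N)%N -> 0 <= shifted_inv x N.
Proof. by move=> N0; rewrite ltW// shifted_inv_gt0. Qed.

Let w0_ge0 N : (0 < N)%N -> 0 <= shifted_inv (0 : R) N.
Proof. by move=> N0; rewrite ltW// shifted_inv_gt0. Qed.

Let c_ge0 n k : (0 <= (connector x n k)%:E)%E.
Proof. by rewrite lee_fin ltW// connector_gt0. Qed.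

Definition connected_sum (s t : seq nat) : \bar R :=
  nested (shifted_inv x) s (fun n =>
    nested (shifted_inv 0) t (fun k => (connector x n k)%:E)).

(** An exponent 1 of the largest variable in the first index is summed out by
    [esum_connectorl]; this multiplies the term by 1/k.  The second index is
    nonempty so that k > 0. *)
Lemma transport_one s b t :
  connected_sum (1%N :: s) (b :: t) = connected_sum s (b.+1 :: t).
Proof.
rewrite /connected_sum nested_cons; congr nested; apply/funext => n.
transitivity (\esum_(N in [set N | (n < N)%N])
    nested (shifted_inv 0) (b :: t)
      (fun k => (shifted_inv x N)%:E * (connector x N k)%:E)%E).
  apply: eq_esum => N nN; rewrite expr1 nestedZl// wx_ge0//.
  exact: leq_ltn_trans nN.
rewrite -nested_esum//; last first.
  move=> N k nN; rewrite mule_ge0// lee_fin wx_ge0//; exact: leq_ltn_trans nN.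
transitivity (nested (shifted_inv 0) (b :: t)
    (fun k => (shifted_inv 0 k * connector x n k)%:E)).
  by apply: nested_eq_pos => k k0; exact: esum_connectorl.
rewrite !nested_cons; congr nested; apply/funext => k.
by apply: eq_esum => M _; rewrite exprSr EFinM muleA -EFinM.
Qed.

(** One factor 1/(n - x) is expanded by [esum_connectorr] into a new largest
    variable of exponent 1 in the second index. *)
Lemma transport_succ a s t :
  connected_sum (a.+2 :: s) t = connected_sum (a.+1 :: s) (1%N :: t).
Proof.
rewrite /connected_sum !nested_cons; congr nested; apply/funext => n.
apply: eq_esum => N nN.
have N0 : (0 < N)%N by exact: leq_ltn_trans nN.
rewrite exprSr EFinM -muleA -nestedZl ?wx_ge0//; congr (_ * _)%E.
rewrite nested_cons; congr nested; apply/funext => k.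
by rewrite -EFinM -esum_connectorr//; apply: eq_esum => M _; rewrite expr1.
Qed.

(** A block ({1}^a, b+2) is consumed by b + 1 expansions, which create b + 1
    entries 1 in t, and then a + 1 summations, which raise the last of these
    entries to a + 2: it has become the dual block ({1}^b, a+2). *)
Lemma transport_block a b s t :
  connected_sum (b.+2 :: nseq a 1%N ++ s) t =
  connected_sum s (a.+2 :: nseq b 1%N ++ t).
Proof.
transitivity (connected_sum (1%N :: nseq a 1%N ++ s) (1%N :: nseq b 1%N ++ t)).
  elim: b t => [|b IH] t; first by rewrite transport_succ.
  rewrite transport_succ IH; congr (connected_sum _ (_ :: _)).
  by elim: b {IH} => //= b ->.
(* The head of the second index, 2 at this point, is generalized to c. *)
rewrite transport_one -[a.+2]addn2; elim: a (2%N) => [|a IH] c //=.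
by rewrite transport_one IH addSnnS.
Qed.

Definition dual_blocks (ab : seq (nat * nat)) : seq (nat * nat) :=
  rev [seq (p.2, p.1) | p <- ab].

Lemma connected_sum_blocks ab t :
  connected_sum (rev (index_of_blocks ab)) t =
  connected_sum [::] (rev (index_of_blocks (dual_blocks ab)) ++ t).
Proof.
elim/last_ind: ab t => [|ab [a b] IH] t //.
rewrite {1}/index_of_blocks map_rcons flatten_rcons rev_cat rev_rcons.
rewrite rev_nseq cat_cons transport_block IH /dual_blocks.
rewrite map_rcons rev_rcons [in RHS]/index_of_blocks/= rev_cat rev_rcons rev_nseq.
by rewrite -catA.
Qed.

Lemma nested_duality ab :
  nested (shifted_inv x) (rev (index_of_blocks ab)) (fun=> 1%E) =
  nested (shifted_inv 0) (rev (index_of_blocks (dual_blocks ab)))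
    (fun k => (connector x 0 k)%:E).
Proof.
have := connected_sum_blocks ab [::].
rewrite cats0 /connected_sum /= => <-; congr nested.
by apply/funext => n; rewrite connector0.
Qed.

(** Since 0 < 1/(N - x) <= 1/(1 - x), all exponents can be reduced to 1 at the
    cost of a constant. *)
Let w_pow_le a N : (0 < a)%N -> (0 < N)%N ->
  shifted_inv x N ^+ a <= (1 - x)^-1 ^+ a.-1 * shifted_inv x N.
Proof.
case: a => // a _ N0; rewrite exprSr ler_wpM2r ?wx_ge0//=.
apply: lerXn2r; rewrite ?nnegrE ?wx_ge0 ?invr_ge0//; first by move: x1; lra.
case: N N0 => // N _; rewrite lef_pV2 ?posrE -?natr1;
  have := ler0n R N; move: x1; lra.
Qed.

(** With all exponents reduced to 1, [esum_connectorl] for k = 1 says that summing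
    out the largest variable reproduces the same connector C(n, 1). *)
Lemma nested_connector1_fin s : all (ltn 0) s ->
  (nested (shifted_inv x) s (fun n => (connector x n 1)%:E) < +oo)%E.
Proof.
elim: s => [|a s IH] /=; first by rewrite ltry.
move=> /andP[a0 /IH{}IH].
set K := (1 - x)^-1 ^+ a.-1.
have K0 : 0 <= K by rewrite exprn_ge0// invr_ge0; move: x1; lra.
apply: (@le_lt_trans _ _
    (K%:E * nested (shifted_inv x) s (fun n => (connector x n 1)%:E))%E); last first.
  by rewrite lte_mul_pinfty.
rewrite -nestedZl//; apply: le_nested => // n.
apply: (@le_trans _ _ (\esum_(N in [set N | (n < N)%N])
    (K%:E * ((shifted_inv x N)%:E * (connector x N 1)%:E)))%E).
  apply: le_esum => N nN; rewrite muleA -!EFinM lee_fin ler_wpM2r//.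
    by rewrite ltW// connector_gt0.
  by apply: w_pow_le => //; exact: leq_ltn_trans nN.
rewrite esumZl//; last first.
  by move=> N nN; rewrite mule_ge0// lee_fin wx_ge0//; exact: leq_ltn_trans nN.
by rewrite (esum_connectorl x1)// /shifted_inv subr0 invr1 mul1r.
Qed.

(** A spare factor 1/(N - x) is comparable to the connector
    C(N, 1) = 1/(N + 1 - x). *)
Lemma nested_fin a s : all (ltn 0) s ->
  nested (shifted_inv x) (a.+2 :: s) (fun=> 1%E) \is a fin_num.
Proof.
move=> s0.
(* The ratio (N + 1 - x) / (N - x) is largest at N = 1. *)
have K0 : 0 <= (2 - x) / (1 - x) by rewrite divr_ge0//; move: x1; lra.
rewrite ge0_fin_numE ?nested_ge0//.
apply: (@le_lt_trans _ _ (((2 - x) / (1 - x))%:E *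
    nested (shifted_inv x) (a.+1 :: s) (fun n => (connector x n 1)%:E))%E); last first.
  by rewrite lte_mul_pinfty// nested_connector1_fin.
rewrite -nestedZl//= ; apply: le_nested => // n; apply: le_esum => N nN.
have N0 : (0 < N)%N by exact: leq_ltn_trans nN.
rewrite mule1 -!EFinM lee_fin exprSr ler_wpM2l ?exprn_ge0 ?wx_ge0//.
rewrite connectorSr connector0 mul1r /shifted_inv.
case: N N0 {nN} => // N _; rewrite -natr1.
have N0 := ler0n R N; set y : R := N%:R in N0 *.
have y1 : 0 < y + 1 - x by move: x1; lra.
rewrite -subr_ge0 (_ : _ - _ = y / ((1 - x) * (y + 1 - x) * (y + 2 - x))); last first.
  by field; do !(apply/andP; split); apply: lt0r_neq0; move: x1; lra.
by rewrite divr_ge0// !mulr_ge0//; move: x1; lra.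
Qed.
End duality.

(** * Generating function of the Bell polynomial sums *)

Section bell_side.
Variables (R : realType) (z : R).
Hypothesis z01 : 0 < z < 1.

Definition odd_inverses (n : nat) : seq R :=
  [seq (2 * k%:R - 1)^-1 | k <- index_iota 1 n.+1].

Lemma odd_gt0 k : (0 < k)%N -> 1 <= 2 * k%:R - 1 :> R.
Proof. by case: k => // k _; rewrite -natr1; have := ler0n R k; lra. Qed.

Lemma modBell_oddharm m n : modBell m (oddharm R n) = hsym (odd_inverses n) m.
Proof.
apply: modBell_psum => i _; rewrite /psum big_map /oddharm.
by apply: eq_bigr => k _; rewrite exprVn.
Qed.

Lemma odd_inverse_bounds k : (0 < k)%N ->
  0 <= (2 * k%:R - 1)^-1 * z < 1 /\ 0 <= (2 * k%:R - 1)^-1 :> R.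
Proof.
move=> /odd_gt0 k1; case/andP: z01 => z0 z1.
have k0 : 0 < 2 * k%:R - 1 :> R by exact: lt_le_trans k1.
split; last by rewrite invr_ge0 ltW.
rewrite mulr_ge0 ?invr_ge0 ?(ltW z0) ?(ltW k0)//= mulrC.
by rewrite ltr_pdivrMr// mul1r (lt_le_trans z1).
Qed.

Lemma odd_inverses_bounds n c : c \in odd_inverses n -> 0 <= c * z < 1 /\ 0 <= c.
Proof.
move=> /mapP[k]; rewrite mem_index_iota => /andP[k0 _] ->.
exact: odd_inverse_bounds.
Qed.

Lemma central_binS n :
  ('C(2 * n.+1, n.+1) * n.+1 = 2 * (2 * n).+1 * 'C(2 * n, n))%N.
Proof.
have E1 := bin_fact (leq_addr n n); have E2 := bin_fact (leq_addr n.+1 n.+1).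
rewrite !addnn -!mul2n in E1 E2.
rewrite (_ : 2 * n - n = n)%N in E1; last by lia.
rewrite (_ : 2 * n.+1 - n.+1 = n.+1)%N in E2; last by lia.
apply/eqP; rewrite -(@eqn_pmul2r (n.+1 * n`! * n`!)); last first.
  by rewrite !muln_gt0 fact_gt0.
rewrite (_ : (2 * n.+1)`! = (2 * n).+2 * (2 * n).+1 * (2 * n)`!)%N in E2; last first.
  by rewrite (_ : 2 * n.+1 = (2 * n).+2)%N ?factS ?mulnA//; lia.
apply/eqP; rewrite factS in E2; nia.
Qed.

(** Both sides are multiplied by (2n+2)/(2n+1-z) = (n+1)/(n+1-x) when n grows by
    one. *)
Lemma central_bin_connector n :
  2 ^+ (2 * n) / 'C(2 * n, n)%:R * \prod_(c <- odd_inverses n) (1 - c * z)^-1 =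
  connector ((1 + z) / 2) 0 n.
Proof.
elim: n => [|n IH].
  rewrite muln0 bin0 /odd_inverses /index_iota/= big_nil connector0.
  by rewrite expr0 invr1 !mulr1.
rewrite connectorSr -{}IH /odd_inverses !big_map big_nat_recr//=.
have := congr1 (fun k => k%:R : R) (central_binS n); rewrite !natrM => E.
have Sn : n.+1%:R = n%:R + 1 :> R by rewrite natr1.
have S2n : (2 * n).+1%:R = 2 * n%:R + 1 :> R by rewrite -natr1 natrM.
set p := \prod_(_ <= _ < _) _.
case/andP: z01 => z0 z1; have n0 := ler0n R n.
have b0 : 0 < 'C(2 * n, n)%:R :> R by rewrite ltr0n bin_gt0; lia.
have b1 : 0 < 'C(2 * n.+1, n.+1)%:R :> R by rewrite ltr0n bin_gt0; lia.
have -> : 'C(2 * n.+1, n.+1)%:R = 2 * (2 * n%:R + 1) * 'C(2 * n, n)%:R / (n%:R + 1) :> R.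
  apply: (@mulIf _ (n%:R + 1)); first by apply: lt0r_neq0; lra.
  rewrite divfK; last by apply: lt0r_neq0; lra.
  by rewrite -S2n -Sn.
rewrite mulnS exprD Sn; set b := 'C(2 * n, n)%:R in b0 *.
field; do !(apply/andP; split); apply: lt0r_neq0; lra.
Qed.

Lemma bell_series (r : nat) (s : seq nat) : size s = r ->
  let term m (k : r.-tuple nat) :=
    2 ^+ (2 * last 0%N k) * modBell m (oddharm R (last 0%N k)) /
       ('C(2 * last 0%N k, last 0%N k)%:R *
        \prod_(i < r) (tnth k i)%:R ^+ nth 0%N s i) in
  (forall m k, 0 <= term m k) /\
  \esum_(m in [set: nat])
     ((z ^+ m)%:E * \esum_(k in increasing_tuples r) (term m k)%:E)%E =
  nested (shifted_inv 0) (rev s) (fun k => (connector ((1 + z) / 2) 0 k)%:E).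
Proof.
move=> sr term; have /andP[z0 z1] := z01.
have term0 m k : 0 <= term m k.
  rewrite /term modBell_oddharm; apply: divr_ge0; apply: mulr_ge0 => //.
    by apply: hsym_ge0 => c /odd_inverses_bounds[].
  by apply: prodr_ge0 => i _; rewrite exprn_ge0.
split=> //.
rewrite -(esum_increasing_nested _ sr); last 2 first.
- by move=> N N0; rewrite invr_ge0 subr0.
- by move=> n; rewrite lee_fin ltW// connector_gt0//; lra.
transitivity (\esum_(m in [set: nat]) \esum_(k in increasing_tuples r)
    (z ^+ m * term m k)%:E)%E.
  apply: eq_esum => m _; rewrite -esumZl ?exprn_ge0 ?(ltW z0)// => k _.
  by rewrite lee_fin.
rewrite exchange_esum; last first.
  by move=> m k _ _; rewrite lee_fin mulr_ge0// exprn_ge0// ltW.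
apply: eq_esum => k kr; set n := last 0%N k.
set p := \prod_(i < r) _; rewrite -central_bin_connector EFinM.
rewrite -esum_hsym ?(ltW z0)//; last exact: odd_inverses_bounds.
rewrite muleA -EFinM -esumZl; last 2 first.
- rewrite !mulr_ge0 ?exprn_ge0 ?invr_ge0//.
  by apply: prodr_ge0 => i _; rewrite exprn_ge0// invr_ge0 subr0.
- move=> m _; rewrite lee_fin mulr_ge0 ?exprn_ge0 ?(ltW z0)//.
  by apply: hsym_ge0 => c /odd_inverses_bounds[].
apply: eq_esum => m _; rewrite -EFinM /term modBell_oddharm -/n; congr (_%:E).
have -> : p = (\prod_(i < r) (tnth k i)%:R ^+ nth 0%N s i)^-1.
  by rewrite -prodfV; apply: eq_bigr => i _; rewrite /shifted_inv subr0 exprVn.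
by rewrite invfM; ring.
Qed.
End bell_side.

(** * Generating function of the multiple t-values *)

Lemma sumn_incr_nth s i : sumn (incr_nth s i) = (sumn s).+1.
Proof.
elim: s i => [|a s IH] [|i] //=; last by rewrite IH addnS.
by elim: i.
Qed.

Section incr_last_facts.
Variables (q : nat) (alpha : q.+1.-tuple nat).

Lemma size_incr_last : size (incr_last alpha) = q.+1.
Proof. by rewrite /incr_last size_incr_nth size_tuple/= ltnS leqnn. Qed.

Lemma nth_incr_last i : nth 0%N (incr_last alpha) i = ((i == q) + nth 0 alpha i)%N.
Proof. by rewrite /incr_last nth_incr_nth size_tuple eq_sym. Qed.

Lemma sumn_incr_last : sumn (incr_last alpha) = (sumn alpha + 1)%N.
Proof. by rewrite /incr_last sumn_incr_nth addn1. Qed.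
End incr_last_facts.

Lemma last_tuple_nth (q : nat) (t : q.+1.-tuple nat) : last 0%N t = nth 0%N t q.
Proof. by rewrite -nth_last size_tuple. Qed.

Lemma finite_sum_tuples (q m : nat) : finite_set [set d : q.-tuple nat | sumn d = m].
Proof.
apply: (@sub_finite_set _ _ ((fun d : q.-tuple 'I_m.+1 => [tuple of map val d]) @` setT)).
  move=> d /= dm; exists [tuple of map inord d] => //; apply: val_inj => /=.
  rewrite -map_comp map_id_in// => i id /=; rewrite inordK// ltnS -dm.
  move: (val d) id => {dm d}; elim=> // j d IH; rewrite in_cons => /orP[/eqP -> /=|/IH].
    exact: leq_addr.
  by move=> /leq_trans; apply => /=; exact: leq_addl.
exact/finite_image/finite_finset.
Qed.

(** The shift of the last entry of alpha by one turns the last binomial into one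
    of the same shape as the others. *)
Lemma coef_prod (q : nat) (alpha d : q.+1.-tuple nat) :
  (Mcoef alpha d * 'C(last 0 alpha + last 0 d, last 0 d) =
   \prod_(i < q.+1)
     'C(nth 0 (incr_last alpha) i + tnth d i - 1, tnth d i))%N.
Proof.
rewrite /Mcoef size_tuple big_mkord big_ord_recr/=; congr (_ * _)%N.
  apply: eq_bigr => i _; rewrite nth_incr_last (tnth_nth 0%N)/=.
  by rewrite (ltn_eqF (ltn_ord i)).
rewrite nth_incr_last (tnth_nth 0%N)/= eqxx !last_tuple_nth.
by rewrite -addnA add1n subn1.
Qed.

Lemma mtv_tuple (R : realType) (q : nat) (alpha d : q.+1.-tuple nat) :
  mtv R (incr_last [tuple (tnth alpha i + tnth d i)%N | i < q.+1]) =
  (\esum_(n in increasing_tuples q.+1)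
    (\prod_(i < q.+1) ((2 * (tnth n i)%:R - 1)^-1 : R) ^+
       (nth 0%N (incr_last alpha) i + tnth d i)%N)%:E)%E.
Proof.
set t := [tuple _ | _ < _]; rewrite /mtv.
have mtv_size s p : size s = p ->
    \esum_(n in increasing_tuples (size s))
      (\prod_(i < size s) (((2 * (tnth n i)%:R - 1) ^+ nth 0%N s i)^-1 : R))%:E =
    \esum_(n in increasing_tuples p)
      (\prod_(i < p) (((2 * (tnth n i)%:R - 1) ^+ nth 0%N s i)^-1 : R))%:E.
  by move=> <-.
rewrite (mtv_size _ _ (size_incr_last t)); apply: eq_esum => n _; congr (_%:E).
apply: eq_bigr => i _; rewrite exprVn !nth_incr_last.
by rewrite -(tnth_nth 0%N) tnth_mktuple -addnA (tnth_nth 0%N).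
Qed.

Section mtv_side.
Variables (R : realType) (z : R).
Hypothesis z01 : 0 < z < 1.

(** The negative binomial series is the generating function of the complete
    homogeneous polynomials in a equal variables. *)
Lemma esum_hsym_nseq (c : R) a : 0 <= c * z < 1 -> 0 <= c ->
  (\esum_(m in [set: nat])
     (2 ^+ a * z ^+ m * ('C(a + m - 1, m)%:R * c ^+ (a + m)))%:E =
   ((2 * c / (1 - c * z)) ^+ a)%:E)%E.
Proof.
move=> cz c0; case/andP: (z01) => z0 z1.
have := @esum_hsym _ (nseq a c) z.
have cs b : b \in nseq a c -> 0 <= b * z < 1 /\ 0 <= b.
  by rewrite mem_nseq => /andP[_ /eqP ->].
move=> /(_ cs (ltW z0)); rewrite big_nseq iter_mulr_1 => E.
transitivity (((2 * c) ^+ a)%:E *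
    \esum_(m in [set: nat]) (hsym (nseq a c) m * z ^+ m)%:E)%E.
  rewrite -esumZl ?exprn_ge0 ?mulr_ge0//; last first.
    move=> m _; rewrite lee_fin mulr_ge0 ?exprn_ge0 ?(ltW z0)//.
    by apply: hsym_ge0 => b /cs[].
  apply: eq_esum => m _; rewrite -EFinM hsym_nseq; congr (_%:E).
  by rewrite exprMn exprD; ring.
by rewrite E -EFinM -exprMn.
Qed.

(** The tuples d of all weights together run over all tuples, so for fixed n the
    sum over d factors into q negative binomial series; the factor for n_i is
    (2 / (2 n_i - 1 - z))^s_i = (n_i - x)^-s_i. *)
Lemma mtv_series (q : nat) (alpha : q.+1.-tuple nat) :
  let coef (d : q.+1.-tuple nat) : \bar R :=
    ((Mcoef alpha d * 'C(last 0 alpha + last 0 d, last 0 d))%N%:R%:E *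
     mtv R (incr_last [tuple (tnth alpha i + tnth d i)%N | i < q.+1]))%E in
  let coefs m : \bar R :=
    ((2 ^+ (sumn alpha + 1))%:E *
      \sum_(d \in [set d : q.+1.-tuple nat | sumn d = m]) coef d)%E in
  (forall m, 0 <= coefs m)%E /\
  (\esum_(m in [set: nat]) ((z ^+ m)%:E * coefs m))%E =
  nested (shifted_inv ((1 + z) / 2)) (rev (incr_last alpha)) (fun=> 1%E).
Proof.
move=> coef coefs; have /andP[z0 z1] := z01.
set s := incr_last alpha; set w : R := 2 ^+ (sumn alpha + 1).
have w0 : 0 <= w by rewrite exprn_ge0.
pose T (d n : q.+1.-tuple nat) : R := \prod_(i < q.+1)
  ('C(nth 0 s i + tnth d i - 1, tnth d i)%:R *
   (2 * (tnth n i)%:R - 1)^-1 ^+ (nth 0%N s i + tnth d i)%N).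
have T0 d n : increasing_tuples q.+1 n -> 0 <= T d n.
  move=> nq; apply: prodr_ge0 => i _; rewrite mulr_ge0// exprn_ge0//.
  by have [] := odd_inverse_bounds z01 (increasing_tuple_gt0 i nq).
have coefE d : coef d = (\esum_(n in increasing_tuples q.+1) (T d n)%:E)%E.
  rewrite /coef mtv_tuple -esumZl//; last first.
    move=> n nq; rewrite lee_fin; apply: prodr_ge0 => i _; rewrite exprn_ge0//.
    by have [] := odd_inverse_bounds z01 (increasing_tuple_gt0 i nq).
  apply: eq_esum => n _; rewrite -EFinM /T big_split/=; congr (_ * _)%:E.
  by rewrite coef_prod natr_prod.
have coef0 d : (0 <= coef d)%E.
  by rewrite coefE; apply: esum_ge0 => n nq; rewrite lee_fin T0.
have coefsE m : coefs m = (w%:E *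
    \esum_(d in [set d : q.+1.-tuple nat | sumn d = m]) coef d)%E.
  by rewrite /coefs esum_fset//; exact: finite_sum_tuples.
split=> [m|].
  by rewrite coefsE mule_ge0// esum_ge0.
transitivity (\esum_(m in [set: nat])
   \esum_(d in [set d : q.+1.-tuple nat | sumn d = m])
     ((w * z ^+ sumn d)%:E * coef d))%E.
  apply: eq_esum => m _; rewrite coefsE muleA -EFinM -esumZl//; last first.
    by rewrite mulr_ge0 ?exprn_ge0 ?(ltW z0).
  by apply: eq_esum => d /= ->; rewrite mulrC.
rewrite -esum_bigcupT; last 2 first.
- by move=> m m' _ _ [d [/= <- <-]].
- by move=> d; rewrite mule_ge0// lee_fin mulr_ge0 ?exprn_ge0 ?(ltW z0).
rewrite (_ : \bigcup_(_ in _) _ = setT); last first.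
  by apply/seteqP; split=> // d _; exists (sumn d).
transitivity (\esum_(d in [set: q.+1.-tuple nat])
    \esum_(n in increasing_tuples q.+1) (w * z ^+ sumn d * T d n)%:E)%E.
  apply: eq_esum => d _; rewrite coefE -esumZl//.
  - by rewrite mulr_ge0 ?exprn_ge0 ?(ltW z0).
  - by move=> n nq; rewrite lee_fin T0.
rewrite exchange_esum; last first.
  by move=> d n _ nq; rewrite lee_fin !mulr_ge0 ?T0 ?exprn_ge0 ?(ltW z0).
rewrite -(esum_increasing_nested _ (size_incr_last alpha))//; last first.
  by move=> N N0; rewrite ltW// shifted_inv_gt0//; lra.
apply: eq_esum => n nq; rewrite mule1.
rewrite -(@esum_prod_tuple _ _ (fun i j => 2 ^+ nth 0%N s i * z ^+ j *
   ('C(nth 0 s i + j - 1, j)%:R *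
    (2 * (tnth n i)%:R - 1)^-1 ^+ (nth 0%N s i + j)%N))).
- apply: eq_esum => d _; rewrite /T !big_split/=; congr (_ * _ * _)%:E.
    rewrite /w -sumn_incr_last -/s sumnE (big_nth 0%N) size_incr_last big_mkord.
    by rewrite prodrXr.
  by rewrite sumnE big_tuple prodrXr.
- move=> i j; have [_ c0] := odd_inverse_bounds z01 (increasing_tuple_gt0 i nq).
  by rewrite !mulr_ge0// exprn_ge0// ltW.
- move=> i; have n0 := increasing_tuple_gt0 i nq.
  have [cz c0] := odd_inverse_bounds z01 n0.
  rewrite esum_hsym_nseq//; congr (_ ^+ _)%:E; rewrite /shifted_inv.
  have := odd_gt0 R n0; set y := (tnth n i)%:R => y1.
  by field; do !(apply/andP; split); apply: lt0r_neq0; lra.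
Qed.
End mtv_side.

(** * The theorem *)

Theorem mainTheorem4 (R : realType) (q r : nat)
    (alpha : q.-tuple nat) (beta : r.-tuple nat) (m : nat) :
  (0 < q)%N -> (0 < r)%N ->
  (forall i : 'I_q, (0 < tnth alpha i)%N) ->
  (sumn alpha + 1 = q + r)%N ->
  dual_index (incr_last alpha) (incr_last beta) ->
  let lhs : \bar R :=
    (\esum_(k in increasing_tuples r)
      (2 ^+ (2 * last 0%N k) * modBell m (oddharm R (last 0%N k)) /
       ('C(2 * last 0%N k, last 0%N k)%:R *
        \prod_(i < r) (tnth k i)%:R ^+ nth 0%N (incr_last beta) i))%:E)%E in
  lhs \is a fin_num /\
  lhs =
    ((2 ^+ (sumn alpha + 1))%:E *
     \sum_(d \in [set d : q.-tuple nat | sumn d = m])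
       ((Mcoef alpha d * 'C(last 0%N alpha + last 0%N d, last 0%N d))%N%:R%:E *
        mtv R (incr_last [tuple (tnth alpha i + tnth d i)%N | i < q])))%E.
Proof.
case: q alpha => // q alpha; case: r beta => // r beta _ _ _ _ [ab [sE s'E]] /=.
(* Nonnegativity of the coefficients is read off at an arbitrary z. *)
have half : 0 < (2^-1 : R) < 1 by apply/andP; split; lra.
pose A k : \bar R := (\esum_(n in increasing_tuples r.+1)
      (2 ^+ (2 * last 0%N n) * modBell k (oddharm R (last 0%N n)) /
       ('C(2 * last 0%N n, last 0%N n)%:R *
        \prod_(i < r.+1) (tnth n i)%:R ^+ nth 0%N (incr_last beta) i))%:E)%E.
have [A0 _] := bell_series half (size_incr_last beta).
have [B0 _] := mtv_series half alpha.
apply: (esum_pow_inj (A := A) _ B0) => [k|z z01].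
  by apply: esum_ge0 => n _; rewrite lee_fin.
have [_ ->] := mtv_series z01 alpha.
have [_ ->] := bell_series z01 (size_incr_last beta).
have x1 : (1 + z) / 2 < 1 by case/andP: z01 => _ z1; lra.
rewrite s'E -/(dual_blocks ab) -nested_duality// -sE; split=> //.
rewrite sE; case/lastP: ab sE {s'E} => [/(congr1 size)|ab [a b] _].
  by rewrite size_incr_last.
rewrite /index_of_blocks map_rcons flatten_rcons rev_cat rev_rcons/=.
apply: nested_fin => //; rewrite all_cat !all_rev; apply/andP; split.
  by rewrite all_nseq orbT.
apply/allP => i /flatten_mapP[[c d] _]; rewrite mem_rcons in_cons mem_nseq.
by move=> /orP[/eqP->|/andP[_ /eqP->]].
Qed.
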